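(* Let $I\subseteq\mathbb{R}$ be an interval and let $f:I\to\mathbb{R}$ be a differentiable function on $I^{\circ}$, the interior of $I$, where $a,b\in I$ with $a<b$. If $f'\in L[a,b]$, then for all $x\in[a,b]$ and all $\alpha>0$, $$\frac{(x-a)^{\alpha}f(a)+(b-x)^{\alpha}f(b)}{b-a}-\frac{\Gamma(\alpha+1)}{b-a}\left[J_{x^{-}}^{\alpha}f(a)+J_{x^{+}}^{\alpha}f(b)\right]$$ $$=\frac{(x-a)^{\alpha+1}}{b-a}\int_{0}^{1}(t^{\alpha}-1)\,f'(tx+(1-t)a)\,dt+\frac{(b-x)^{\alpha+1}}{b-a}\int_{0}^{1}(1-t^{\alpha})\,f'(tx+(1-t)b)\,dt.$$
   Context: $\Gamma(\alpha)=\int_0^\infty e^{-u}u^{\alpha-1}\,du$ is the Euler Gamma function. The Riemann-Liouville fractional integrals of order $\alpha>0$ are $J_{c^{+}}^{\alpha}f(y)=\frac{1}{\Gamma(\alpha)}\int_{c}^{y}(y-t)^{\alpha-1}f(t)\,dt$ for $y>c$ and $J_{d^{-}}^{\alpha}f(y)=\frac{1}{\Gamma(\alpha)}\int_{y}^{d}(t-y)^{\alpha-1}f(t)\,dt$ for $y<d$. Thus $$J_{x^{-}}^{\alpha}f(a)=\frac{1}{\Gamma(\alpha)}\int_{a}^{x}(t-a)^{\alpha-1}f(t)\,dt,\qquad J_{x^{+}}^{\alpha}f(b)=\frac{1}{\Gamma(\alpha)}\int_{x}^{b}(b-t)^{\alpha-1}f(t)\,dt,$$ where the first is $0$ if $x=a$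 and the second is $0$ if $x=b$; likewise the term on the right-hand side with factor $(x-a)^{\alpha+1}$ is $0$ if $x=a$, and the one with factor $(b-x)^{\alpha+1}$ is $0$ if $x=b$. $f'\in L[a,b]$ means that $f'$ is Lebesgue integrable on $[a,b]$ (its values at the two points $a,b$ being immaterial).
   Formalization: Continuity of f on [a,b] is added: if a or b is an endpoint of I, f may jump there and the identity fails (I=[0,1], f the indicator of {0}, a=0, b=x=α=1 gives 1=0). It is automatic at interior points of I and necessary for the identity for all x. *)

(* Defs.v *)
From HB Require Import structures.
From mathcomp Require Import all_boot all_order all_algebra.
From mathcomp Require Import all_classical all_reals all_analysis.

Set Implicit Arguments.
Unset Strict Implicit.
Unset Printing Implicit Defensive.

Import Order.TTheory GRing.Theory Num.Theory.
Import numFieldNormedType.Exports.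

Local Open Scope classical_set_scope.
Local Open Scope ring_scope.

(* For exponents alpha - 1 < 0 the library sets [0 `^ (alpha - 1)] to 0, so the
   integrands below take a conventional value at one endpoint, a null set. *)

Definition Gamma (R : realType) (alpha : R) : R :=
  \int[@lebesgue_measure R]_(u in `]0, +oo[) (expR (- u) * u `^ (alpha - 1)).

(* J_{c+}^alpha f (y); equal to 0 when y = c *)
Definition RLplus (R : realType) (alpha c : R) (f : R -> R) (y : R) : R :=
  (Gamma alpha)^-1 *
  \int[@lebesgue_measure R]_(t in `[c, y]) ((y - t) `^ (alpha - 1) * f t).

(* J_{d-}^alpha f (y); equal to 0 when y = d *)
Definition RLminus (R : realType) (alpha d : R) (f : R -> R) (y : R) : R :=
  (Gamma alpha)^-1 *
  \int[@lebesgue_measure R]_(t in `[y, d]) ((t - y) `^ (alpha - 1) * f t).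

(* Main.v *)
Require Import Defs.
From HB Require Import structures.
From mathcomp Require Import all_boot all_order all_algebra.
From mathcomp Require Import all_classical all_reals all_analysis.
From mathcomp Require Import measurable_realfun ring lra.

(** On each side of x the identity is one integration by parts. With c equal to
    a or b, v := x - c and phi t := f (c + t * v) on [0, 1], the fundamental
    theorem of calculus gives

      phi 1 = alpha \int_0^1 t^(alpha-1) phi + \int_0^1 t^alpha phi'
        (for the primitive t^alpha phi, which vanishes at 0), and
      phi 1 - phi 0 = \int_0^1 phi',

    hence phi 0 - alpha \int_0^1 t^(alpha-1) phi = \int_0^1 (t^alpha - 1) phi'
    ([unit_interval_identity]). The substitution s = c + t * v turns this into
    the identity for one endpoint ([endpoint_identity]); the factor alpha is
    Gamma (alpha + 1) / Gamma alpha. Adding the two endpoints gives the theorem.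

    The delicate point is the fundamental theorem itself: f' exists everywhere
    in the open interval but is only Lebesgue integrable, so nothing is known
    about its continuity, and f is not assumed absolutely continuous. It is
    enough to bound increments of f above by the integral of any integrable
    majorant p of f' and to apply this to f and to - f. If p >= 0, let P be its
    indefinite integral. By Lebesgue differentiation P' = p >= f' outside a null
    set N; on N, where P may behave badly, P is still nondecreasing, and f' is
    finite, so adding e * W, with W nondecreasing, of total increase at most 1
    and of infinite derivative on N, makes P + e * W + e * id grow locally
    faster than f at every point ([infinite_derivative_on_null_set]). A
    continuity argument ([increment_le_of_right_local]) makes this global, and e
    tends to 0. A majorant bounded below is reduced to p >= 0 by adding a linear
    function to f, and the general case follows by truncating p from below and
    dominated convergence ([increment_le_integral], [integral_derivative]). *)

Set Implicit Arguments.
Unset Strict Implicit.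
Unset Printing Implicit Defensive.

Import Order.TTheory GRing.Theory Num.Theory.
Import numFieldNormedType.Exports.

Local Open Scope classical_set_scope.
Local Open Scope ring_scope.

(** * From local to global increments *)

(** Fix c > a and let s be the supremum of the y in [c, b] such that
    f y - Q y <= f c - Q c. Left continuity of f and monotonicity of Q give this
    inequality at s, and the local hypothesis at s would push it further to the
    right if s < b. Hence s = b; then c tends to a. Jumps of Q go up and only
    help, which is why monotonicity can replace continuity for Q. *)
Lemma increment_le_of_right_local (R : realType) (f Q : R -> R) (a b : R) : a < b ->
  {within `[a, b], continuous f} ->
  {in `[a, b] &, {homo Q : x y / x <= y}} ->
  (forall x, x \in `]a, b[ ->
    \forall y \near x^'+, f y - f x <= Q y - Q x) ->
  f b - f a <= Q b - Q a.
Proof.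
move=> ab /(continuous_within_itvP _ ab) [cf fa fb] ndQ incr.
have fl s : a < s -> s <= b -> f y @[y --> s^'-] --> f s.
  move=> as_; rewrite le_eqVlt => /predU1P[->//|sb].
  by apply: cvg_at_left_filter; apply: cf; rewrite in_itv/= as_.
have main c : c \in `]a, b[ -> f b - f c <= Q b - Q c.
  move=> /[!in_itv]/= /andP[ac cb].
  pose S := [set y | c <= y <= b /\ f y - Q y <= f c - Q c].
  have Sc : S c by split; rewrite ?lexx ?(ltW cb).
  have Sb : ubound S b by move=> y [/andP[]].
  have hS : has_sup S by split; [exists c|exists b].
  pose s := sup S.
  have cs : c <= s by exact: (sup_upper_bound hS).
  have sb : s <= b by apply: ge_sup => //; exists c.
  have as_ : a < s by exact: lt_le_trans cs.
  have Ss : f s - Q s <= f c - Q c.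
    rewrite leNgt; apply/negP => Ks.
    have : \forall y \near s^'-, f c - Q c + Q s < f y.
      by apply: (cvgr_gt _ (fl s as_ sb)); rewrite -ltrBrDr.
    rewrite near_withinE => -[e /= e0 he].
    have [y [/andP[cy yb] Ky] sy] := sup_adherent e0 hS.
    have ys : y <= s by apply: (sup_upper_bound hS); rewrite /S/= cy yb.
    move: ys; rewrite le_eqVlt => /predU1P[ys|ys].
      by move: Ks; rewrite -ys ltNge Ky.
    have : f c - Q c + Q s < f y.
      apply: he => //=; rewrite ger0_norm ?subr_ge0 ?(ltW ys)//.
      by rewrite ltrBlDr addrC -ltrBlDr.
    apply/negP; rewrite -leNgt.
    move: Ky; rewrite lerBlDr => /le_trans; apply; rewrite lerD2l.
    apply: (ndQ _ _ _ _ (ltW ys)).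
      by rewrite in_itv/= yb (le_trans _ cy) ?ltW.
    by rewrite in_itv/= sb ltW.
  move: sb; rewrite le_eqVlt => /predU1P[sb|sb].
    by move: Ss; rewrite sb; lra.
  exfalso.
  have sab : s \in `]a, b[ by rewrite in_itv/= as_.
  near s^'+ => y.
  have sy : s < y by near: y; exact: nbhs_right_gt.
  have yb : y <= b by near: y; exact: nbhs_right_le.
  have fy : f y - f s <= Q y - Q s by near: y; exact: incr.
  have : S y.
    split; last by lra.
    by rewrite yb (le_trans cs)// ltW.
  move=> /(sup_upper_bound hS); rewrite -/s leNgt sy//.
rewrite lerBlDr -lerBlDl; apply/ler_addgt0Pr => e e0.
near a^'+ => c.
have cab : c \in `]a, b[.
  by rewrite in_itv/=; apply/andP; split; near: c;
    [exact: nbhs_right_gt|exact: nbhs_right_lt].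
have := main c cab.
have : Q a <= Q c.
  by apply: ndQ; move: cab; rewrite !in_itv/= ?lexx ?(ltW ab)//
    => /andP[/ltW ac /ltW cb]; rewrite ?ac ?cb.
have : f c < f a + e.
  by near: c; apply: (cvgr_lt _ fa); rewrite ltrDl.
lra.
Unshelve. all: by end_near. Qed.

(** * A function with infinite derivative on a null set *)

(** Cover N by open sets V n of measure at most 2^-(n+1), and let W be the
    distribution function of the measure nu := \sum_n mu (- `&` V n), of total
    mass at most 1. A point of N lies in every V n, so a short interval to its
    right lies in the first k of them and has nu-mass at least k times its
    length. *)
Lemma infinite_derivative_on_null_set (R : realType) (N : set R) :
  (@lebesgue_measure R).-negligible N ->
  exists W : R -> R, {homo W : x y / x <= y} /\
    (forall x y, W y - W x <= 1) /\
    (forall x, N x -> forall M, \forall y \near x^'+, M * (y - x) <= W y - W x).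
Proof.
move=> [A [mA A0 NA]].
have /choice[V VP] : forall n, exists U : set R, [/\ open U, A `<=` U &
    (@lebesgue_measure R U <= (1 / (2 ^ n.+1)%:R)%:E)%E].
  move=> n; have e0 : 0 < 1 / (2 ^ n.+1)%:R :> R.
    by rewrite divr_gt0// ltr0n expn_gt0.
  have [|U [oU AU UA]] := lebesgue_regularity_outer mA _ e0.
    by rewrite [X in (X < _)%E]A0.
  exists U; split=> //.
  rewrite -[X in lebesgue_measure X](setDUK AU).
  apply: (le_trans (measureU2 _ _ _)) => //.
    by apply: measurableD => //; exact: open_measurable.
  by rewrite [X in (X + _)%E]A0 add0e ltW.
have mV n : measurable (V n : set (measurableTypeR R)).
  by apply: open_measurable; case: (VP n).
pose nu : {measure set (measurableTypeR R) -> \bar R} :=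
  mseries (fun n => mrestr (@lebesgue_measure R) (mV n)) 0.
have nu1 : (nu setT <= 1)%E.
  apply: le_trans (epsilon_trick0 xpredT (@ler01 R)).
  rewrite /nu /mseries /=; apply: lee_nneseries => // n _ /=.
  by have [_ _] := VP n; rewrite -[X in (lebesgue_measure X <= _)%E -> _]setTI.
have nuS (B : set R) : measurable B -> (nu B <= 1)%E.
  by move=> mB; apply: le_trans nu1; apply: le_measure; rewrite ?inE//.
have nuf (B : set R) : measurable B -> nu B \is a fin_num.
  by move=> mB; rewrite ge0_fin_numE ?(le_lt_trans (nuS _ mB)) ?ltry.
pose W (y : R) := fine (nu (`]-oo, y]%classic : set R)).
have WB x y : x <= y -> W y - W x = fine (nu (`]x, y]%classic : set R)).
  move=> xy; rewrite /W (@itv_bndbnd_setU _ _ _ (BRight x))//.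
  rewrite measureU//=.
    by rewrite fineD ?nuf// addrC addKr.
  apply/seteqP; split => z //=; rewrite 2!in_itv/= => -[zx /andP[]].
  by rewrite ltNge zx.
have W0 x y : x <= y -> W x <= W y.
  by move=> xy; rewrite -subr_ge0 WB// fine_ge0.
exists W; split => //; split.
  move=> x y; have [xy|/ltW yx] := leP x y; last first.
    by rewrite (@le_trans _ _ 0)// subr_le0 W0.
  by rewrite WB// -lee_fin fineK ?nuf// nuS.
move=> x Nx M.
have xV n : V n x by case: (VP n) => _ AO _; apply/AO/NA.
(* the first k open sets already give slope k >= M *)
pose k := (Num.truncn `|M|).+1.
have Mk : M <= k%:R.
  by rewrite (le_trans (ler_norm _))// ltW// truncnS_gt.
have near_sub : \forall y \near x^'+, forall n : 'I_k, `]x, y] `<=` V n.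
  apply: filter_forall => n.
  have [oVn _ _] := VP n.
  have [e /= e0 he] := oVn _ (xV n).
  near=> y => z /=; rewrite in_itv/= => /andP[xz zy].
  apply: he => /=; rewrite distrC gtr0_norm ?subr_gt0// ltrBlDl.
  rewrite (le_lt_trans zy)//; near: y; apply: nbhs_right_lt.
  by rewrite ltrDl.
near=> y.
have xy : x < y by near: y; exact: nbhs_right_gt.
have sub : forall n : 'I_k, `]x, y] `<=` V n by near: y.
rewrite WB ?(ltW xy)// -lee_fin fineK ?nuf//.
have H : ((k%:R * (y - x))%:E <= nu (`]x, y]%classic : set R))%E.
  rewrite /nu/= /mseries.
  apply: (le_trans _ (@nneseries_lim_ge _ _ xpredT 0 k _)) => //=.
  rewrite big_mkord (eq_bigr (fun=> (y - x)%:E)); last first.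
    move=> n _; rewrite /mrestr setIidl; last exact: sub.
    by rewrite lebesgue_measure_itv/= lte_fin xy EFinB.
  by rewrite sumEFin sumr_const card_ord mulr_natl.
apply: le_trans H; rewrite lee_fin ler_wpM2r// subr_ge0 ltW//.
Unshelve. all: by end_near. Qed.

(** * The fundamental theorem of calculus for everywhere differentiable functions *)

Lemma right_slope_near (R : realType) (f : R -> R) (x d e : R) :
  is_derive x 1 f d -> 0 < e ->
  \forall y \near x^'+, `|f y - f x - d * (y - x)| <= e * (y - x).
Proof.
move=> [df fd] e0.
have /cvgrPdist_le/(_ e e0) : h^-1 *: (f (h *: 1 + x) - f x) @[h --> 0^'] --> d.
  by rewrite -fd; exact: df.
rewrite near_withinE => -[r /= r0 hr].
near=> y.
have xy : x < y by near: y; exact: nbhs_right_gt.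
have yx0 : 0 < y - x by rewrite subr_gt0.
have := hr (y - x); rewrite /= sub0r normrN gtr0_norm// gt_eqF// => /(_ _ isT).
have -> : (y - x) *: 1 + x = y by rewrite /GRing.scale/= mulr1 subrK.
have yr : y - x < r.
  rewrite ltrBlDl; near: y; apply: nbhs_right_lt; by rewrite ltrDl.
move=> /(_ yr); rewrite /GRing.scale/= => H.
have -> : f y - f x - d * (y - x) = - (y - x) * (d - (y - x)^-1 * (f y - f x)).
  field; exact: lt0r_neq0.
by rewrite normrM normrN (gtr0_norm yx0) mulrC ler_pM2r.
Unshelve. all: by end_near. Qed.

(** The comparison function is Q := P + e * W + e * id, with P the indefinite
    integral of p and W infinitely steep on the null set where P' = p fails.
    The three nondecreasing terms play complementary parts: P dominates f off
    the null set, W dominates f on it, and e * id absorbs the error terms of the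
    difference quotients. *)
Lemma increment_le_integral_of_ge0 (R : realType) (f g p : R -> R) (a b : R) :
  a < b -> {within `[a, b], continuous f} ->
  (forall x, x \in `]a, b[ -> is_derive x 1 f (g x)) ->
  (forall x, x \in `]a, b[ -> 0 <= p x) ->
  (forall x, x \in `]a, b[ -> g x <= p x) ->
  (@lebesgue_measure R).-integrable `]a, b[ (EFin \o p) ->
  f b - f a <= \int[@lebesgue_measure R]_(t in `]a, b[) p t.
Proof.
move=> ab cf df p0 gp intp.
pose q := p \_ `]a, b[.
have q0 x : 0 <= q x.
  rewrite /q patchE; case: ifPn => // /set_mem; exact: p0.
have intq : (@lebesgue_measure R).-integrable setT (EFin \o q).
  rewrite /q -restrict_EFin; apply/integrable_restrict => //=.
  by rewrite setTI.
have intqS (D : set R) : measurable D ->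
    (@lebesgue_measure R).-integrable D (EFin \o q).
  by move=> mD; apply: integrableS intq.
pose P y := \int[@lebesgue_measure R]_(t in `]-oo, y]) q t.
have ndP x y : x <= y -> P x <= P y.
  move=> xy; rewrite /P /Rintegral fine_le ?integrable_fin_num ?intqS//.
  apply: ge0_subset_integral => //=.
  - by have /integrableP[] := intqS _ (measurable_itv `]-oo, y]).
  - by move=> z _; rewrite lee_fin.
  - by apply: subset_itvl; rewrite bnd_simp.
have P0 x : 0 <= P x by apply: Rintegral_ge0 => z _.
have Pp x : P x <= \int[@lebesgue_measure R]_(t in `]a, b[) p t.
  rewrite [leRHS]Rintegral_mkcond -/q /P /Rintegral.
  rewrite fine_le ?integrable_fin_num ?intqS//.
  apply: ge0_subset_integral => //=.
  - by have /integrableP[] := intq.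
  - by move=> z _; rewrite lee_fin.
have locq : locally_integrable [set: R] q.
  by apply: open_integrable_locally => //; exact: openT.
have negP : (@lebesgue_measure R).-negligible
    [set x | ~ (derivable P x 1 /\ derive1 P x = q x)].
  exact: (FTC1Ny (fun y => intqS _ (measurable_itv `]-oo, y])) locq).
have [W [ndW [W1 WN]]] := infinite_derivative_on_null_set negP.
apply/ler_addgt0Pr => e' e'0.
(* over [a, b], e * W and e * id increase by at most e and e * (b - a) *)
pose e := e' / (1 + (b - a)).
have ba0 : 0 < 1 + (b - a) by rewrite addr_gt0// subr_gt0.
have e0 : 0 < e by rewrite divr_gt0.
pose Q y := P y + e * W y + e * y.
have : f b - f a <= Q b - Q a.
  apply: (increment_le_of_right_local ab cf).
    move=> x y _ _ xy; rewrite /Q; apply: lerD; last by rewrite ler_pM2l.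
    by apply: lerD; [exact: ndP|rewrite ler_pM2l// ndW].
  move=> x xab.
  have [[dP P'x]|Nx] := pselect (derivable P x 1 /\ derive1 P x = q x).
    have isP : is_derive x 1 P (p x).
      apply: DeriveDef => //; move: P'x; rewrite derive1E => ->.
      by rewrite /q patchE mem_set.
    have e20 : 0 < e / 2 by rewrite divr_gt0.
    have nf := right_slope_near (df x xab) e20.
    have nP := right_slope_near isP e20.
    near=> y.
    have xy : x < y by near: y; exact: nbhs_right_gt.
    have := ndW _ _ (ltW xy); rewrite -subr_ge0 -(pmulr_rge0 _ e0).
    have : `|f y - f x - g x * (y - x)| <= e / 2 * (y - x) by near: y.
    have : `|P y - P x - p x * (y - x)| <= e / 2 * (y - x) by near: y.
    have : g x * (y - x) <= p x * (y - x).
      by rewrite ler_wpM2r ?gp// subr_ge0 ltW.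
    rewrite !ler_norml /Q => ? /andP[? ?] /andP[? ?] ?; lra.
  have nf := right_slope_near (df x xab) e0.
  have nW := WN x Nx (g x / e).
  near=> y.
  have xy : x < y by near: y; exact: nbhs_right_gt.
  have := ndP _ _ (ltW xy).
  have : `|f y - f x - g x * (y - x)| <= e * (y - x) by near: y.
  have : g x / e * (y - x) <= W y - W x by near: y.
  rewrite mulrAC ler_pdivrMr// ler_norml /Q => ? /andP[? ?] ?; lra.
have := W1 a b; have := Pp b; have := P0 a; rewrite /Q => ? ? Wab ?.
have : e * (W b - W a) <= e * 1 by rewrite ler_pM2l.
have : e * (1 + (b - a)) = e' by rewrite /e divfK// gt_eqF.
lra.
Unshelve. all: by end_near. Qed.

(** Truncating p from below at - n keeps it above f' and bounds it below, so
    that f + n * id and max(p, - n) + n fall under the nonnegative case; the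
    terms in n cancel, and n tends to infinity by dominated convergence. *)
Lemma increment_le_integral (R : realType) (f g p : R -> R) (a b : R) :
  a < b -> {within `[a, b], continuous f} ->
  (forall x, x \in `]a, b[ -> is_derive x 1 f (g x)) ->
  (forall x, x \in `]a, b[ -> g x <= p x) ->
  (@lebesgue_measure R).-integrable `]a, b[ (EFin \o p) ->
  f b - f a <= \int[@lebesgue_measure R]_(t in `]a, b[) p t.
Proof.
move=> ab cf df gp intp.
have mp : measurable_fun `]a, b[ p by have /integrableP[/measurable_EFinP] := intp.
pose pn (n : nat) x := Num.max (p x) (- n%:R).
have mpn n : measurable_fun `]a, b[ (pn n) by exact: measurable_maxr.
have pn_le n x : `|pn n x| <= `|p x|.
  rewrite /pn; have := ler0n R n; set m := n%:R => m0.
  rewrite /Num.max; case: ltP => pm; last by [].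
  by rewrite normrN (ger0_norm m0) ltr0_norm; lra.
have intpn n : (@lebesgue_measure R).-integrable `]a, b[ (EFin \o pn n).
  apply: (le_integrable _ _ _ intp) => //.
    by apply/measurable_EFinP; exact: mpn.
  by move=> x _; rewrite lee_fin; exact: pn_le.
have intn (r : R) : (@lebesgue_measure R).-integrable `]a, b[ (EFin \o cst r).
  apply: measurable_bounded_integrable => //.
    by rewrite /= lebesgue_measure_itv/=; case: ifPn => // _; rewrite ltry.
  exact: bounded_cst.
have lepn n : (f b - f a <= \int[@lebesgue_measure R]_(t in `]a, b[) pn n t).
  have id1 (x : R) : is_derive x 1 (fun y => n%:R * y) n%:R.
    by apply: is_derive_eq; rewrite /GRing.scale/= mulr1.
  have H := @increment_le_integral_of_ge0 R (fun y => f y + n%:R * y)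
    (fun y => g y + n%:R) (fun y => pn n y + n%:R) a b ab _ _ _ _ _.
  have {H} := H _ _ _ _ _; rewrite RintegralD ?intpn ?intn//.
  rewrite Rintegral_cst//= lebesgue_measure_itv/= lte_fin ab/=.
  move=> H; suff : f b + n%:R * b - (f a + n%:R * a) <=
    \int[lebesgue_measure]_(x in `]a, b[) pn n x + n%:R * (b - a) by lra.
  apply: H.
  - move=> x; apply: cvgD; first exact: cf.
    apply: continuous_subspaceT => {}x.
    by apply: cvgM; [exact: cvg_cst|exact: cvg_id].
  - by move=> x xab; apply: is_deriveD; exact: df.
  - by move=> x xab; rewrite -lerBlDr sub0r /pn le_max lexx orbT.
  - by move=> x xab; rewrite lerD2r /pn le_max gp.
  - exact: (@integrableD _ _ R (@lebesgue_measure R) _ (measurable_itv `]a, b[)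
      _ _ (intpn n) (intn n%:R)).
have := @dominated_convergence _ _ R (@lebesgue_measure R) `]a, b[
  (measurable_itv _) (fun n => EFin \o pn n) (EFin \o p) (fun x => `|p x|%:E).
case => //.
- by move=> n; apply/measurable_EFinP; exact: mpn.
- exact/measurable_EFinP.
- apply: aeW => x _; apply: cvg_near_cst.
  near=> n; congr EFin; rewrite /pn; apply/max_idPl.
  rewrite lerNl (le_trans (ler_norm _))// normrN.
  by near: n; exact: nbhs_infty_ger.
- exact: integrable_norm.
- by apply: aeW => x n _ /=; rewrite lee_fin.
move=> _ _ H.
rewrite -lee_fin /Rintegral fineK ?integrable_fin_num//.
apply: (cvge_to_ge H); near=> n.
by rewrite -[X in (_ <= X)%E]fineK ?integrable_fin_num// lee_fin; exact: lepn.
Unshelve. all: by end_near. Qed.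

(** The integral bounds the increment of f from above, and the same bound for
    - f is the reverse inequality. *)
Lemma integral_derivative (R : realType) (f g : R -> R) (a b : R) :
  a < b -> {within `[a, b], continuous f} ->
  (forall x, x \in `]a, b[ -> is_derive x 1 f (g x)) ->
  (@lebesgue_measure R).-integrable `]a, b[ (EFin \o g) ->
  \int[@lebesgue_measure R]_(t in `]a, b[) g t = f b - f a.
Proof.
move=> ab cf df intg; apply/eqP; rewrite eq_le; apply/andP; split; last first.
  by apply: (increment_le_integral ab cf df).
have : (- f b) - (- f a) <= \int[@lebesgue_measure R]_(t in `]a, b[) (-1 * g t).
  apply: (@increment_le_integral _ (fun x => - f x) (fun x => -1 * g x) _ a b ab).
  - by move=> x; apply: cvgN; exact: cf.
  - by move=> x xab; rewrite mulN1r; apply: is_deriveN; exact: df.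
  - by [].
  - exact: (@integrableZl _ _ R (@lebesgue_measure R) _ (measurable_itv `]a, b[)
      (-1) _ intg).
by rewrite RintegralZl//; lra.
Qed.

(** The bounded functions min(g, n) are integrable and their opposites majorize
    the derivative of - f, so their integrals are at most f b - f a; monotone
    convergence gives the integrability of g. It is used for the singular
    weights t^(alpha-1) with alpha < 1. *)
Lemma integrable_derivative_ge0 (R : realType) (f g : R -> R) (a b : R) :
  a < b -> {within `[a, b], continuous f} ->
  (forall x, x \in `]a, b[ -> is_derive x 1 f (g x)) ->
  (forall x, x \in `]a, b[ -> 0 <= g x) ->
  measurable_fun `]a, b[ g ->
  (@lebesgue_measure R).-integrable `]a, b[ (EFin \o g).
Proof.
move=> ab cf df g0 mg.
pose gn (n : nat) x := Num.min (g x) n%:R.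
have gn0 n x : x \in `]a, b[ -> 0 <= gn n x.
  by move=> xab; rewrite /gn le_min ler0n andbT g0.
have mgn n : measurable_fun `]a, b[ (gn n) by exact: measurable_minr.
have intgn n : (@lebesgue_measure R).-integrable `]a, b[ (EFin \o gn n).
  apply: measurable_bounded_integrable => //.
    by rewrite /= lebesgue_measure_itv/=; case: ifPn => // _; rewrite ltry.
    exact: mgn.
  exists n%:R; split; rewrite ?num_real// => M nM x xab /=.
  rewrite ger0_norm ?gn0// (le_trans _ (ltW nM))//.
  by rewrite /gn ge_min lexx orbT.
have gn_le n : (\int[@lebesgue_measure R]_(t in `]a, b[) (gn n t)%:E <=
    (f b - f a)%:E)%E.
  have : (- f b) - (- f a) <=
      \int[@lebesgue_measure R]_(t in `]a, b[) (-1 * gn n t).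
    apply: (@increment_le_integral _ (fun x => - f x) (fun x => - g x) _ a b ab).
    - by move=> x; apply: cvgN; exact: cf.
    - by move=> x xab; apply: is_deriveN; exact: df.
    - by move=> x xab; rewrite mulN1r lerN2 /gn ge_min lexx.
    - exact: (@integrableZl _ _ R (@lebesgue_measure R) _
        (measurable_itv `]a, b[) (-1) _ (intgn n)).
  rewrite RintegralZl//.
  rewrite -[X in (X <= _)%E]fineK; last exact: integrable_fin_num (intgn n).
  by rewrite lee_fin /Rintegral; lra.
apply/integrableP; split; first exact/measurable_EFinP.
apply: (@le_lt_trans _ _ (f b - f a)%:E); last by rewrite ltry.
have H : (\int[@lebesgue_measure R]_(t in `]a, b[) (gn n t)%:E)%E @[n --> \oo] -->
    (\int[@lebesgue_measure R]_(t in `]a, b[) limn (fun n => (gn n t)%:E))%E.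
  apply: cvg_monotone_convergence => //.
  - by move=> n; apply/measurable_EFinP; exact: mgn.
  - move=> x xab m n mn; rewrite lee_fin /gn le_min ge_min lexx/=.
    by rewrite ge_min ler_nat mn orbT.
have -> : (\int[@lebesgue_measure R]_(t in `]a, b[) `|(EFin \o g) t| =
    \int[@lebesgue_measure R]_(t in `]a, b[) limn (fun n => (gn n t)%:E))%E.
  apply: eq_integral => x; rewrite inE => xab; apply/esym/cvg_lim => //.
  apply: cvg_near_cst; near=> n; rewrite /= ger0_norm ?g0//; congr EFin.
  apply/min_idPl; rewrite (le_trans (ler_norm _))//.
  by near: n; exact: nbhs_infty_ger.
by apply: (cvge_to_le H); near=> n; exact: gn_le.
Unshelve. all: by end_near. Qed.

(** * Affine substitution in Lebesgue integrals *)

(** The two sides are measures that agree on half-open intervals. *)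
Lemma lebesgue_measure_affine (R : realType) (c v : R) (v0 : v != 0)
    (X : set (measurableTypeR R)) : measurable X ->
  lebesgue_measure X = (`|v|%:E *
    pushforward lebesgue_measure
      ((fun t : R => c + t * v)%R : measurableTypeR R -> measurableTypeR R) X)%E.
Proof.
move=> mX.
set A : measurableTypeR R -> measurableTypeR R := fun t : R => c + t * v.
have mA : measurable_fun setT A.
  by apply: measurable_funD => //; exact: measurable_funM.
pose nu := mscale (NngNum (normr_ge0 v))
  (measure_function_pushforward__canonical__measure_function_Measure
    lebesgue_measure mA).
suff nuE : forall Y : set (measurableTypeR R), ocitv Y -> lebesgue_measure Y = nu Y.
  exact: (lebesgue_measure_unique nuE mX).
move=> _ [[a b]] _ <-.
rewrite (_ : nu _ = (`|v|%:E * lebesgue_measure (A @^-1` `]a, b]))%E)//.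
have [vn|vp] := ltP v 0.
  have -> : A @^-1` `]a, b] = `[(b - c) / v, (a - c) / v[%classic.
    apply/seteqP; split=> t; rewrite /A/= !in_itv/=;
      rewrite ler_ndivrMr// ltr_ndivlMr//;
      by move=> /andP[? ?]; apply/andP; split; lra.
  rewrite !lebesgue_measure_itv/= !lte_fin ltr_nM2r ?invr_lt0// ltrD2r.
  case: ifPn => ab; last by rewrite mule0.
  by rewrite -!EFinB -EFinM ltr0_norm//; congr EFin; field.
have {vp} vp : 0 < v by rewrite lt_neqAle eq_sym v0.
have -> : A @^-1` `]a, b] = `](a - c) / v, (b - c) / v]%classic.
  apply/seteqP; split=> t; rewrite /A/= !in_itv/=;
    rewrite ler_pdivlMr// ltr_pdivrMr//;
    by move=> /andP[? ?]; apply/andP; split; lra.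
rewrite !lebesgue_measure_itv/= !lte_fin ltr_pM2r ?invr_gt0// ltrD2r.
case: ifPn => ab; last by rewrite mule0.
by rewrite -!EFinB -EFinM gtr0_norm//; congr EFin; field.
Qed.

Lemma ge0_integral_affine (R : realType) (c v : R) (v0 : v != 0)
    (D : set R) (f : R -> \bar R) : measurable D ->
  measurable_fun D f -> {in D, forall y, 0 <= f y}%E ->
  (\int[@lebesgue_measure R]_(y in D) f y =
   `|v|%:E * \int[@lebesgue_measure R]_(t in (fun t : R => c + t * v)%R @^-1` D)
      f (c + t * v)%R)%E.
Proof.
move=> mD mf f0.
set A : measurableTypeR R -> measurableTypeR R := fun t : R => c + t * v.
have mA : measurable_fun setT A.
  by apply: measurable_funD => //; exact: measurable_funM.
pose nu := mscale (NngNum (normr_ge0 v))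
  (measure_function_pushforward__canonical__measure_function_Measure
    lebesgue_measure mA).
rewrite -(ge0_integral_pushforward mA) //.
rewrite (eq_measure_integral nu); last first.
  by move=> X mX _; exact: lebesgue_measure_affine.
by rewrite ge0_integral_mscale// => x Dx; apply: f0; rewrite inE.
Qed.

Lemma integrable_affine (R : realType) (c v : R) (v0 : v != 0)
    (D : set R) (f : R -> R) : measurable D ->
  (@lebesgue_measure R).-integrable D (EFin \o f) ->
  (@lebesgue_measure R).-integrable ((fun t => c + t * v) @^-1` D)
    (EFin \o (fun t => f (c + t * v))).
Proof.
move=> mD /integrableP[mf foo].
have mA : measurable_fun (setT : set (measurableTypeR R))
   ((fun t => c + t * v) : measurableTypeR R -> measurableTypeR R).
  by apply: measurable_funD => //; exact: measurable_funM.
have mAD : measurable ((fun t : R => c + t * v) @^-1` D).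
  by rewrite -[X in measurable X]setTI; exact: mA.
apply/integrableP; split.
  apply: (@measurable_comp _ _ _ _ _ _ D (EFin \o f)) => //.
  by move=> _ [x Dx <-].
  exact: measurable_funS mA.
move: foo; rewrite (ge0_integral_affine c v0)//; last first.
  exact: measurableT_comp.
have vp : 0 < `|v| by rewrite normr_gt0.
set i := (\int[_]_(t in _) _)%E.
have : (0 <= i)%E by apply: integral_ge0.
case: i => //= [r _ _|_]; first exact: ltry.
by rewrite gt0_muley ?lte_fin// ltxx.
Qed.

Lemma Rintegral_affine (R : realType) (c v : R) (v0 : v != 0)
    (D : set R) (f : R -> R) : measurable D ->
  (@lebesgue_measure R).-integrable D (EFin \o f) ->
  \int[@lebesgue_measure R]_(y in D) f y =
   `|v| * \int[@lebesgue_measure R]_(t in (fun t : R => c + t * v)%R @^-1` D)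
      f (c + t * v)%R.
Proof.
move=> mD intf; have intfA := integrable_affine c v0 mD intf.
have mf := measurable_int _ intf.
have mA : measurable ((fun t : R => c + t * v) @^-1` D : set (measurableTypeR R)).
  by rewrite -[X in measurable X]setTI; apply: measurable_funD => //;
    exact: measurable_funM.
have /fineK := integrable_pos_fin_num mA intfA; set p := fine _ => pK.
have /fineK := integrable_neg_fin_num mA intfA; set n := fine _ => nK.
rewrite /Rintegral integralE [in RHS]integralE.
rewrite (ge0_integral_affine c v0 mD) //; last exact: measurable_funepos.
rewrite [X in (_ - X)%E](ge0_integral_affine c v0 mD) //; last first.
  exact: measurable_funeneg.
rewrite -[in RHS]pK -[in RHS]nK -EFinB /= mulrBr.
transitivity (fine (`|v|%:E * p%:E - `|v|%:E * n%:E)%E) => //.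
by congr (fine (_ * _ - _ * _)%E); rewrite (pK, nK);
  apply: eq_integral => t _; rewrite ?funeposE ?funenegE.
Qed.

(** * Integration by parts against a power *)

Lemma powR_continuous_within (R : realType) (b alpha : R) : 0 < b -> 0 < alpha ->
  {within `[0, b], continuous (fun t : R => t `^ alpha)}.
Proof.
move=> b0 a0.
have cp x : 0 < x -> {for x, continuous (fun t : R => t `^ alpha)}.
  move=> x0; have : derivable (fun t : R => t `^ alpha) x 1.
    by apply: derivable_powR; rewrite in_itv/= x0.
  by move/derivable1_diffP/differentiable_continuous.
apply/continuous_within_itvP => //; split.
- by move=> x; rewrite in_itv/= => /andP[x0 _]; exact: cp.
- by rewrite powR0 ?gt_eqF//; exact: powR_cvg0.
- by apply: cvg_at_left_filter; exact: cp.
Qed.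

Lemma integrableM_continuous (R : realType) (a b : R) (h F : R -> R) :
  {within `[a, b], continuous F} ->
  (@lebesgue_measure R).-integrable `]a, b[ (EFin \o h) ->
  (@lebesgue_measure R).-integrable `]a, b[ (EFin \o (fun t => h t * F t)).
Proof.
move=> cF inth.
have mF : measurable_fun `[a, b] F by exact: subspace_continuous_measurable_fun.
apply: (@integrableMl _ _ R (@lebesgue_measure R) _ (measurable_itv `]a, b[)
  (EFin \o h) F) => //.
  by apply: measurable_funS mF => //; exact: subset_itv_oo_cc.
have /compact_bounded[M [_ mrt]] := continuous_compact cF (@segment_compact _ _ _).
exists M; split; rewrite ?num_real// => r Mr x xab.
by apply: (mrt r Mr); exists x => //; exact: subset_itv_oo_cc.
Qed.

Lemma integrable_powR (R : realType) (b alpha : R) : 0 < b -> 0 < alpha ->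
  (@lebesgue_measure R).-integrable `]0, b[ (fun t => (t `^ (alpha - 1))%:E).
Proof.
move=> b0 a0.
have H : (@lebesgue_measure R).-integrable `]0, b[
    (EFin \o (fun t => alpha * t `^ (alpha - 1))).
  apply: (integrable_derivative_ge0 b0 (powR_continuous_within b0 a0)).
  - by move=> x; rewrite in_itv/= => /andP[x0 _]; exact: is_derive1_powR.
  - by move=> x _; rewrite mulr_ge0 ?powR_ge0// ltW.
  - apply: measurable_funM => //.
    exact: (measurableT_comp (@measurable_powR R (alpha - 1))
      (@measurable_id _ _ _)).
have := @integrableZl _ _ R (@lebesgue_measure R) _ (measurable_itv `]0, b[)
  alpha^-1 _ H.
apply: eq_integrable => // t _ /=; rewrite -EFinM mulKf// gt_eqF//.
Qed.

(** This is the fundamental theorem for the primitive t^alpha * F t. At 0 the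
    derivative of t^alpha may be infinite, but t^alpha is continuous there and
    its derivative is integrable, which is all that the theorem asks for. *)
Lemma integration_by_parts_powR (R : realType) (F G : R -> R) (b alpha : R) :
  0 < b -> 0 < alpha -> {within `[0, b], continuous F} ->
  (forall t : R, t \in `]0, b[ -> is_derive t 1 F (G t)) ->
  (@lebesgue_measure R).-integrable `]0, b[ (EFin \o G) ->
  b `^ alpha * F b =
    alpha * \int[@lebesgue_measure R]_(t in `]0, b[) (t `^ (alpha - 1) * F t)
    + \int[@lebesgue_measure R]_(t in `]0, b[) (t `^ alpha * G t).
Proof.
move=> b0 a0 cF dF intG.
have cp := powR_continuous_within b0 a0.
have int1 := integrableM_continuous cF (integrable_powR b0 a0).
have int2 : (@lebesgue_measure R).-integrable `]0, b[
    (EFin \o (fun t => t `^ alpha * G t)).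
  have := integrableM_continuous cp intG.
  by apply: eq_integrable => // t _ /=; rewrite mulrC.
have int1' := @integrableZl _ _ R (@lebesgue_measure R) _ (measurable_itv `]0, b[)
  alpha _ int1.
rewrite -RintegralZl// -RintegralD//.
have -> : b `^ alpha * F b = b `^ alpha * F b - 0 `^ alpha * F 0.
  by rewrite powR0 ?gt_eqF// mul0r subr0.
symmetry; apply: (@integral_derivative R (fun t => t `^ alpha * F t)
  (fun t => alpha * (t `^ (alpha - 1) * F t) + t `^ alpha * G t) 0 b) => //.
- by move=> t; apply: cvgM; [exact: cp|exact: cF].
- move=> t tb; have := dF t tb; move: tb; rewrite in_itv/= => /andP[t0 _] dFt.
  have dp := is_derive1_powR alpha t0.
  apply: is_derive_eq; rewrite /GRing.scale/=; ring.
- exact: (@integrableD _ _ R (@lebesgue_measure R) _ (measurable_itv `]0, b[)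
      _ _ int1' int2).
Qed.

(** * The Gamma function *)

(** Raise s <= exp s, for s := t / (2 alpha), to the power alpha. *)
Lemma powR_le_expR (R : realType) (alpha : R) : 0 < alpha ->
  exists2 C : R, 0 < C & forall t : R, 0 <= t -> t `^ alpha <= C * expR (t / 2).
Proof.
move=> a0; have a2 : 0 < 2 * alpha by rewrite mulr_gt0.
exists ((2 * alpha) `^ alpha); first by rewrite powR_gt0.
move=> t t0; set s := t / (2 * alpha).
have s0 : 0 <= s by rewrite divr_ge0// ltW.
have -> : t = 2 * alpha * s by rewrite /s mulrC divfK// gt_eqF.
have -> : 2 * alpha * s / 2 = s * alpha by field.
rewrite powRM ?(ltW a2)// expRM ler_pM2l ?powR_gt0//.
apply: ge0_ler_powR; rewrite ?nnegrE ?expR_ge0 ?(ltW a0)//.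
by rewrite (le_trans _ (expR_ge1Dx _))// lerDr.
Qed.

Lemma is_derive_affine (R : realType) (f : R -> R) (c v t d : R) :
  is_derive (c + t * v) 1 f d ->
  is_derive t 1 (fun t => f (c + t * v)) (d * v).
Proof.
move=> df; apply: (@is_derive1_comp _ f (fun t => c + t * v)).
apply: is_derive_eq; rewrite /GRing.scale/=; ring.
Qed.

Lemma is_derive_expRM (R : realType) (r t : R) :
  is_derive t 1 (fun t : R => expR (t * r)) (expR (t * r) * r).
Proof.
have := @is_derive_affine R expR 0 r t _ (is_derive_expR _).
by rewrite add0r; under eq_fun do rewrite add0r.
Qed.

Lemma is_derive_expRN (R : realType) (t : R) :
  is_derive t 1 (fun t : R => expR (- t)) (- expR (- t)).
Proof.
have := is_derive_expRM (-1) t.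
by rewrite !mulrN1; under eq_fun do rewrite mulrN1.
Qed.

Lemma continuous_expRN (R : realType) : continuous (fun t : R => expR (- t)).
Proof.
by move=> x; apply: (@continuous_comp _ _ _ -%R (@expR R));
  [exact: opp_continuous|exact: continuous_expR].
Qed.

Lemma integrable_expRN_powR (R : realType) (b alpha : R) : 0 < b -> 0 < alpha ->
  (@lebesgue_measure R).-integrable `]0, b[
    (EFin \o (fun t => t `^ (alpha - 1) * expR (- t))).
Proof.
move=> b0 a0; apply: (integrableM_continuous _ (integrable_powR b0 a0)).
exact/continuous_subspaceT/continuous_expRN.
Qed.

(** The functional equation of Gamma before passage to the limit; the boundary
    term b^alpha e^(-b) vanishes as b tends to infinity. *)
Lemma partial_Gamma_rec (R : realType) (b alpha : R) : 0 < b -> 0 < alpha ->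
  alpha * \int[@lebesgue_measure R]_(t in `]0, b[) (t `^ (alpha - 1) * expR (- t))
  = b `^ alpha * expR (- b) +
    \int[@lebesgue_measure R]_(t in `]0, b[) (t `^ (alpha + 1 - 1) * expR (- t)).
Proof.
move=> b0 a0.
have a10 : 0 < alpha + 1 by rewrite addr_gt0.
have intG : (@lebesgue_measure R).-integrable `]0, b[
    (EFin \o (fun t : R => - expR (- t))).
  have := @integrable_expRN_powR R b 1 b0 ltr01.
  move/(@integrableZl _ _ R (@lebesgue_measure R) _ (measurable_itv `]0, b[) (-1)).
  apply: eq_integrable => // t _ /=.
  by rewrite subrr powRr0 mul1r -EFinM mulN1r.
rewrite (integration_by_parts_powR (F := fun t : R => expR (- t))
  b0 a0 _ _ intG) //.
- have -> : \int[@lebesgue_measure R]_(t in `]0, b[) (t `^ alpha * - expR (- t)) =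
    \int[@lebesgue_measure R]_(t in `]0, b[)
      (-1 * (t `^ (alpha + 1 - 1) * expR (- t))).
    by apply: eq_Rintegral => t _; rewrite addrK mulrN mulN1r.
  rewrite RintegralZl//; last exact: integrable_expRN_powR.
  ring.
- exact/continuous_subspaceT/continuous_expRN.
- by move=> t _; exact: is_derive_expRN.
Qed.

(** By [partial_Gamma_rec] it suffices to bound b^alpha e^(-b) and the integral
    of t^alpha e^(-t), which has no singularity at 0: both follow from
    t^alpha e^(-t) <= C e^(-t/2). *)
Lemma partial_Gamma_bounded (R : realType) (alpha : R) : 0 < alpha ->
  exists K : R, forall b : R, 0 < b ->
    \int[@lebesgue_measure R]_(t in `]0, b[) (t `^ (alpha - 1) * expR (- t)) <= K.
Proof.
move=> a0; have [C C0 hC] := powR_le_expR a0.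
exists ((C + C * 2) / alpha) => b b0.
rewrite ler_pdivlMr// mulrC partial_Gamma_rec//.
have half (t : R) : 0 <= t -> t `^ alpha * expR (- t) <= C * expR (- (t / 2)).
  move=> t0; have -> : - (t / 2) = t / 2 + - t by field.
  by rewrite expRD mulrA ler_pM2r ?expR_gt0// hC.
apply: lerD.
  apply: (le_trans (half b (ltW b0))); rewrite -[leRHS]mulr1 ler_pM2l//.
  by rewrite expR_le1 oppr_le0 divr_ge0// ltW.
have cE (r : R) : continuous (fun t : R => expR (t * r)).
  move=> x; have [dE _] := is_derive_expRM r x.
  by move/derivable1_diffP/differentiable_continuous : dE.
have dE (t : R) : is_derive t 1 (fun t : R => - (2 * C) * expR (t * - 2^-1))
    (C * expR (t * - 2^-1)).
  have dE := is_derive_expRM (- 2^-1) t.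
  by apply: is_derive_eq; rewrite /GRing.scale/=; field.
have cF : {within `[0, b], continuous (fun t : R => - (2 * C) * expR (t * - 2^-1))}.
  apply: continuous_subspaceT => t; apply: cvgM; [exact: cvg_cst|exact: cE].
have intE : (@lebesgue_measure R).-integrable `]0, b[
    (EFin \o (fun t : R => C * expR (t * - 2^-1))).
  apply: (integrable_derivative_ge0 b0 cF) => //.
    by move=> t _; rewrite mulr_ge0 ?expR_ge0// ltW.
  apply: measurable_funTS; apply: continuous_measurable_fun => t.
  by apply: cvgM; [exact: cvg_cst|exact: cE].
apply: (@le_trans _ _ (\int[@lebesgue_measure R]_(t in `]0, b[)
    (C * expR (t * - 2^-1)))).
  apply: le_Rintegral => //.
    by apply: integrable_expRN_powR => //; rewrite addr_gt0.
  move=> t /=; rewrite in_itv/= => /andP[/ltW t0 _].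
  by rewrite addrK mulrN; exact: half.
rewrite (integral_derivative b0 cF) //.
rewrite mul0r expR0 mulr1 mulNr opprK addrC mulrC.
by rewrite lerBlDr lerDl mulr_ge0 ?expR_ge0 ?mulr_ge0// ltW.
Qed.

(** Monotone convergence gives the limit in the extended reals; the uniform
    bound makes it finite, so that the real number [Gamma alpha] is this limit
    and not a default value. *)
Lemma partial_Gamma_cvg (R : realType) (alpha : R) : 0 < alpha ->
  \int[@lebesgue_measure R]_(t in `]0, n.+1%:R[) (t `^ (alpha - 1) * expR (- t))
    @[n --> \oo] --> Gamma alpha.
Proof.
move=> a0; have [K hK] := partial_Gamma_bounded a0.
pose h (t : R) := (t `^ (alpha - 1) * expR (- t))%:E.
have mh (D : set R) : measurable D -> measurable_fun D h.
  move=> mD; apply/measurable_EFinP; apply: measurable_funM.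
    by apply: measurable_funTS; exact: measurable_powR.
  apply: measurable_funTS; apply: continuous_measurable_fun.
  exact: continuous_expRN.
have h0 t : (0 <= h t)%E by rewrite lee_fin mulr_ge0 ?powR_ge0 ?expR_ge0.
pose D n : set R := `]0, n.+1%:R[%classic.
have n0 n : (0 : R) < n.+1%:R by rewrite ltr0n.
have bigD : \bigcup_n D n = `]0, +oo[%classic.
  apply/seteqP; split => [t [n _]|t]; rewrite /D/= !in_itv/=.
    by move=> /andP[->].
  rewrite andbT => t0; exists (Num.truncn t) => //=.
  by rewrite in_itv/= t0 truncnS_gt.
have cvg_int : (\int[@lebesgue_measure R]_(t in D n) h t)%E @[n --> \oo] -->
    (\int[@lebesgue_measure R]_(t in `]0%R, +oo[) h t)%E.
  rewrite -bigD; apply: ge0_nondecreasing_set_cvg_integral => //.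
  - move=> m n mn; rewrite subsetEset => t; rewrite /D/= !in_itv/= => /andP[-> tm].
    by rewrite (lt_le_trans tm)// ler_nat ltnS.
  - by move=> n; exact: measurable_itv.
  - by move=> n; apply: mh; exact: measurable_itv.
have DE n : (\int[@lebesgue_measure R]_(t in D n) h t)%E =
    (\int[@lebesgue_measure R]_(t in `]0, n.+1%:R[)
      (t `^ (alpha - 1) * expR (- t)))%:E.
  rewrite /Rintegral fineK//; apply: integrable_fin_num => //.
  exact: integrable_expRN_powR.
have int_fin : (\int[@lebesgue_measure R]_(t in `]0%R, +oo[) h t)%E \is a fin_num.
  rewrite ge0_fin_numE; last by apply: integral_ge0 => t _; exact: h0.
  rewrite (@le_lt_trans _ _ K%:E) ?ltry//.
  by apply: (cvge_to_le cvg_int); apply: nearW => n; rewrite DE lee_fin; exact: hK.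
have intE : (\int[@lebesgue_measure R]_(t in `]0%R, +oo[) h t)%E = (Gamma alpha)%:E.
  rewrite -[LHS]fineK//; congr (fine _)%:E.
  by apply: eq_integral => t _; rewrite /h mulrC.
apply: fine_cvg; rewrite -intE.
exact: cvg_int.
Qed.

Lemma powR_expRN_cvg0 (R : realType) (alpha : R) : 0 < alpha ->
  (n.+1%:R `^ alpha * expR (- n.+1%:R) : R) @[n --> \oo] --> (0 : R).
Proof.
move=> a0; have a10 : 0 < alpha + 1 by rewrite addr_gt0.
have [C C0 hC] := powR_le_expR a10.
apply: (@squeeze_cvgr _ _ _ _ (cst 0) (fun n => C * n.+1%:R^-1)).
- apply: nearW => n.
  have n0 : (0 : R) < n.+1%:R by rewrite ltr0n.
  rewrite mulr_ge0 ?powR_ge0 ?expR_ge0//=.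
  rewrite ler_pdivlMr// mulrAC.
  have -> : n.+1%:R `^ alpha * n.+1%:R = n.+1%:R `^ (alpha + 1) :> R.
    by rewrite powRD ?powRr1 ?ler0n// gt_eqF// implybT.
  rewrite (le_trans (ler_wpM2r _ (hC _ (ltW n0))))// ?expR_ge0//.
  rewrite -mulrA -expRD -[leRHS]mulr1 ler_pM2l// expR_le1; lra.
- exact: cvg_cst.
- rewrite -(mulr0 C); apply: cvgM; first exact: cvg_cst.
  exact: cvg_harmonic.
Qed.

(** By [partial_Gamma_rec] with b = 1, the integral over ]0, 1[ alone is at least
    e^(-1) / alpha. *)
Lemma Gamma_gt0 (R : realType) (alpha : R) : 0 < alpha -> 0 < Gamma alpha.
Proof.
move=> a0; have cv := partial_Gamma_cvg a0.
have e0 : 0 < expR (-1) / alpha by rewrite divr_gt0 ?expR_gt0.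
apply: (lt_le_trans e0); apply: (cvgr_to_ge cv); apply: nearW => n.
have h0 (t : R) : 0 <= t `^ (alpha - 1) * expR (- t).
  by rewrite mulr_ge0 ?powR_ge0 ?expR_ge0.
have intn m := @integrable_expRN_powR R m.+1%:R alpha (ltr0Sn _ m) a0.
apply: (@le_trans _ _ (\int[@lebesgue_measure R]_(t in `]0, 1[)
    (t `^ (alpha - 1) * expR (- t)))).
  rewrite ler_pdivrMr// mulrC partial_Gamma_rec// powR1 mul1r lerDl.
  by apply: Rintegral_ge0 => t _; rewrite mulr_ge0 ?powR_ge0 ?expR_ge0.
rewrite fine_le ?integrable_fin_num ?(intn 0)//.
apply: ge0_subset_integral => //=.
- by have /integrableP[] := intn n.
- by move=> t _; rewrite lee_fin.
- by apply: subset_itvl; rewrite bnd_simp ler1n.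
Qed.

Lemma GammaS (R : realType) (alpha : R) : 0 < alpha ->
  Gamma (alpha + 1) = alpha * Gamma alpha.
Proof.
move=> a0; have a10 : 0 < alpha + 1 by rewrite addr_gt0.
have cv : alpha * \int[@lebesgue_measure R]_(t in `]0, n.+1%:R[)
    (t `^ (alpha - 1) * expR (- t)) @[n --> \oo] --> alpha * Gamma alpha.
  by apply: cvgM; [exact: cvg_cst|exact: partial_Gamma_cvg].
have cv1 : alpha * \int[@lebesgue_measure R]_(t in `]0, n.+1%:R[)
    (t `^ (alpha - 1) * expR (- t)) @[n --> \oo] --> Gamma (alpha + 1).
  under eq_fun do rewrite partial_Gamma_rec//.
  rewrite -[Gamma (alpha + 1)]add0r.
  by apply: cvgD; [exact: powR_expRN_cvg0|exact: partial_Gamma_cvg].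
exact: (cvg_unique (@Rhausdorff R) cv1 cv).
Qed.

(** * The identity for one endpoint *)

Lemma integrable_itv_oo_cc (R : realType) (a b : R) (f : R -> R) :
  (@lebesgue_measure R).-integrable `]a, b[ (EFin \o f) ->
  (@lebesgue_measure R).-integrable `[a, b] (EFin \o f).
Proof.
move=> /integrableP[mf foo]; apply/integrableP; split.
  by apply/emeasurable_fun_itv_obnd_cbndP/emeasurable_fun_itv_bndo_bndcP.
by rewrite integral_itv_bndoo//; exact: measurableT_comp.
Qed.

Lemma Rintegral_itv_cc_oo (R : realType) (a b : R) (f : R -> R) :
  (@lebesgue_measure R).-integrable `]a, b[ (EFin \o f) ->
  \int[@lebesgue_measure R]_(t in `[a, b]) f t =
  \int[@lebesgue_measure R]_(t in `]a, b[) f t.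
Proof.
by move=> /integrableP[mf _]; rewrite /Rintegral integral_itv_bndoo.
Qed.

(** Integration by parts against t^alpha, minus the fundamental theorem for F:
    the value F 1 cancels. *)
Lemma unit_interval_identity (R : realType) (F G : R -> R) (alpha : R) :
  0 < alpha -> {within `[0, 1], continuous F} ->
  (forall t : R, t \in `]0, 1[ -> is_derive t 1 F (G t)) ->
  (@lebesgue_measure R).-integrable `]0, 1[ (EFin \o G) ->
  F 0 - alpha * \int[@lebesgue_measure R]_(t in `]0, 1[) (t `^ (alpha - 1) * F t)
  = \int[@lebesgue_measure R]_(t in `]0, 1[) ((t `^ alpha - 1) * G t).
Proof.
move=> a0 cF dF intG.
have parts := integration_by_parts_powR (@ltr01 R) a0 cF dF intG.
have ftc := integral_derivative (@ltr01 R) cF dF intG.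
have int2 : (@lebesgue_measure R).-integrable `]0, 1[
    (EFin \o (fun t => t `^ alpha * G t)).
  have := integrableM_continuous (powR_continuous_within (@ltr01 R) a0) intG.
  by apply: eq_integrable => // t _ /=; rewrite mulrC.
under [RHS]eq_Rintegral do rewrite mulrBl mul1r.
rewrite RintegralB// ftc; move: parts; rewrite powR1 mul1r; lra.
Qed.

Lemma within_continuous_affine (R : realType) (c v : R) (D E : set R) (f : R -> R) :
  (forall t, E t -> D (c + t * v)) -> {within D, continuous f} ->
  {within E, continuous (fun t => f (c + t * v))}.
Proof.
move=> ED /subspace_continuousP cf; apply/subspace_continuousP => t Et.
apply: cvg_comp (cf _ (ED _ Et)).
move=> U; rewrite /within/= => nU.
have cA : {for t, continuous (fun t : R => c + t * v)}.
  by apply: cvgD; [exact: cvg_cst|apply: cvgM; [exact: cvg_id|exact: cvg_cst]].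
change (\forall s \near t, E s -> U (c + s * v)).
near=> s => Es.
have : D (c + s * v) -> U (c + s * v) by near: s; exact: (cA _ nU).
by apply; exact: ED.
Unshelve. all: by end_near. Qed.

(** The set D is the closed interval with endpoints c and c + v, written as a
    preimage of [0, 1] so that one statement covers v > 0 and v < 0. The proof
    transports [unit_interval_identity] along s = c + t * v; the factor |v| of
    the substitution and the |v|^(alpha-1) coming out of |s - c|^(alpha-1)
    combine to |v|^alpha. *)
Lemma endpoint_identity (R : realType) (f df : R -> R) (c v alpha : R) (D : set R) :
  v != 0 -> 0 < alpha ->
  D = (fun s : R => - c / v + s * v^-1) @^-1` `[0, 1] ->
  {within D, continuous f} ->
  (forall t : R, t \in `]0, 1[ -> is_derive (c + t * v) 1 f (df (c + t * v))) ->
  (@lebesgue_measure R).-integrable D (EFin \o df) ->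
  (@lebesgue_measure R).-integrable `[0, 1]
    (EFin \o (fun t => (t `^ alpha - 1) * df (c + t * v))) /\
  `|v| `^ alpha * f c -
    alpha * \int[@lebesgue_measure R]_(s in D) (`|s - c| `^ (alpha - 1) * f s)
  = `|v| `^ alpha * v *
    \int[@lebesgue_measure R]_(t in `[0, 1]) ((t `^ alpha - 1) * df (c + t * v)).
Proof.
move=> v0 a0 DE cf dF intdf.
have ADE : (fun t : R => c + t * v) @^-1` D = `[0, 1]%classic.
  have KA t : - c / v + (c + t * v) / v = t by field.
  by rewrite DE; apply/seteqP; split => t /=; rewrite KA.
have mD : measurable D.
  rewrite -[D]setTI DE; apply: measurable_funD => //; exact: measurable_funM.
have intG : (@lebesgue_measure R).-integrable `]0, 1[
    (EFin \o (fun t => df (c + t * v))).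
  have := integrable_affine c v0 mD intdf; rewrite ADE.
  by apply: integrableS => //; exact: subset_itv_oo_cc.
have cF : {within `[0, 1], continuous (fun t => f (c + t * v))}.
  apply: within_continuous_affine cf => t; rewrite -ADE//.
have dphi (t : R) : t \in `]0, 1[ ->
    is_derive t 1 (fun t => f (c + t * v)) (df (c + t * v) * v).
  by move=> t01; apply: is_derive_affine; exact: dF.
have intGv : (@lebesgue_measure R).-integrable `]0, 1[
    (EFin \o (fun t => df (c + t * v) * v)).
  apply: (integrableM_continuous _ intG) => t; exact: cvg_cst.
have intK : (@lebesgue_measure R).-integrable `]0, 1[
    (EFin \o (fun t => (t `^ alpha - 1) * df (c + t * v))).
  have cK : {within `[0, 1], continuous (fun t : R => t `^ alpha - 1)}.
    by move=> t; apply: cvgB; [exact: powR_continuous_within|exact: cvg_cst].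
  have := integrableM_continuous cK intG.
  by apply: eq_integrable => // t _ /=; rewrite mulrC.
split; first exact: integrable_itv_oo_cc.
have intP := integrableM_continuous cF (integrable_powR (@ltr01 R) a0).
have vp : 0 < `|v| by rewrite normr_gt0.
(* integrability on D comes from [0, 1] by the inverse substitution *)
have intQ : (@lebesgue_measure R).-integrable D
    (EFin \o (fun s => `|s - c| `^ (alpha - 1) * f s)).
  have := integrable_affine (- c / v) (invr_neq0 v0) (measurable_itv `[0, 1])
    (integrable_itv_oo_cc intP).
  rewrite -DE.
  move/(@integrableZl _ _ R (@lebesgue_measure R) _ mD (`|v| `^ (alpha - 1))).
  apply: eq_integrable => // s; rewrite DE inE /= in_itv/= => /andP[t0 _].
  rewrite -EFinM mulrA -powRM// ?(ltW vp)//.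
  have -> : c + (- c / v + s / v) * v = s by field.
  congr (_ `^ _ * _)%:E.
  rewrite -{1}(ger0_norm t0) -normrM; congr `|_|; field.
  exact: v0.
rewrite (Rintegral_affine c v0 mD intQ) ADE.
have -> : \int[@lebesgue_measure R]_(t in `[0, 1])
    (`|c + t * v - c| `^ (alpha - 1) * f (c + t * v)) =
  `|v| `^ (alpha - 1) * \int[@lebesgue_measure R]_(t in `]0, 1[)
    (t `^ (alpha - 1) * f (c + t * v)).
  rewrite -RintegralZl// -Rintegral_itv_cc_oo; last first.
    exact: (@integrableZl _ _ R (@lebesgue_measure R) _ (measurable_itv `]0, 1[)
      _ _ intP).
  apply: eq_Rintegral => t; rewrite inE/= in_itv/= => /andP[t0 _].
  rewrite addrC addKr normrM (ger0_norm t0) powRM// mulrA; ring.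
rewrite Rintegral_itv_cc_oo//.
have := unit_interval_identity a0 cF dphi intGv; rewrite mul0r addr0.
have -> : \int[@lebesgue_measure R]_(t in `]0, 1[)
    ((t `^ alpha - 1) * (df (c + t * v) * v)) =
  v * \int[@lebesgue_measure R]_(t in `]0, 1[)
    ((t `^ alpha - 1) * df (c + t * v)).
  by rewrite -RintegralZl//; apply: eq_Rintegral => t _; ring.
move=> unit_id; rewrite -[RHS]mulrA -unit_id.
rewrite mulrBr; congr (_ - _).
rewrite -(mulr_powRB1 (ltW vp) a0); ring.
Qed.

(** * Both endpoints *)

(* f is a total function, but only its values on I matter: the derivative is
   used in the interior of I, and derive1 f at a or b (possibly junk, when a or b is
   an endpoint of I) only contributes a null set or a term with factor 0.
   The continuity of f on [a, b] is automatic at interior points of I; at an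
   endpoint of I belonging to {a, b} it is needed: for f the indicator of {0} on
   I = [0, 1], a = 0, b = x = alpha = 1, the two sides are 1 and 0. *)
Theorem lemma2 (R : realType) (I : set R) (f : R -> R) (a b : R)
    (hI : is_interval I)
    (hdiff : forall y : R, I° y -> derivable f y 1)
    (ha : I a) (hb : I b) (hab : a < b)
    (hcont : {within `[a, b], continuous f})
    (hint : (@lebesgue_measure R).-integrable `[a, b] (EFin \o derive1 f)) :
  forall x : R, x \in `[a, b] -> forall alpha : R, 0 < alpha ->
    ((x - a) `^ alpha * f a + (b - x) `^ alpha * f b) / (b - a)
    - Gamma (alpha + 1) / (b - a)
      * (RLminus alpha x f a + RLplus alpha x f b)
    = (x - a) `^ (alpha + 1) / (b - a)
      * \int[@lebesgue_measure R]_(t in `[0, 1])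
          ((t `^ alpha - 1) * derive1 f (t * x + (1 - t) * a))
    + (b - x) `^ (alpha + 1) / (b - a)
      * \int[@lebesgue_measure R]_(t in `[0, 1])
          ((1 - t `^ alpha) * derive1 f (t * x + (1 - t) * b)).

Proof.
move=> x xab alpha a0.
have Ga0 := Gamma_gt0 a0.
have ba0 : b - a != 0 by rewrite subr_eq0 gt_eqF.
have a10 : 0 < alpha + 1 by rewrite addr_gt0.
have p0 (y r : R) : 0 < r -> (y - y) `^ r = 0.
  by move=> r0; rewrite subrr powR0// gt_eqF.
have df y : y \in `]a, b[ -> is_derive y 1 f (derive1 f y).
  move=> yab; rewrite derive1E; apply/derivableP/hdiff.
  apply: filterS (near_in_itvoo yab) => z; rewrite in_itv/= => /andP[az zb].
  by apply: (hI a b ha hb); rewrite !ltW.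
have left_half : (x - a) `^ alpha * f a - alpha *
    \int[@lebesgue_measure R]_(t in `[a, x]) ((t - a) `^ (alpha - 1) * f t) =
    (x - a) `^ (alpha + 1) * \int[@lebesgue_measure R]_(t in `[0, 1])
          ((t `^ alpha - 1) * derive1 f (t * x + (1 - t) * a)).
  move: xab; rewrite in_itv/= => /andP[+ xb]; rewrite le_eqVlt => /predU1P[<-|ax].
    rewrite (p0 _ _ a0) (p0 _ _ a10) 2!mul0r.
    by rewrite set_itv1 Rintegral_set1 mulr0 subr0.
  have v0 : 0 < x - a by rewrite subr_gt0.
  have sub : `[a, x] `<=` `[a, b] by apply: subset_itvl; rewrite bnd_simp.
  have DE : `[a, x]%classic =
      (fun s : R => - a / (x - a) + s * (x - a)^-1) @^-1` `[0, 1].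
    apply/seteqP; split => s /=; rewrite -mulrDl addrC !in_itv/= ler_pdivrMr//
      ler_pdivlMr// mul0r mul1r subr_ge0 lerD2r//.
  have dfx (t : R) : t \in `]0, 1[ ->
      is_derive (a + t * (x - a)) 1 f (derive1 f (a + t * (x - a))).
    rewrite in_itv/= => /andP[t0 t1]; apply: df; rewrite in_itv/=.
    by apply/andP; split; nra.
  have intdf : (@lebesgue_measure R).-integrable `[a, x] (EFin \o derive1 f).
    by apply: integrableS hint.
  have [_ id_] := endpoint_identity (lt0r_neq0 v0) a0 DE
    (continuous_subspaceW sub hcont) dfx intdf.
  have vE : (x - a) `^ (alpha + 1) = (x - a) `^ alpha * (x - a).
    by rewrite powRD ?powRr1 ?(ltW v0)// (gt_eqF v0) implybT.
  rewrite (gtr0_norm v0) -vE in id_.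
  under [X in _ = _ * X]eq_Rintegral => t _.
    rewrite (_ : t * x + (1 - t) * a = a + t * (x - a)); last by ring.
    over.
  rewrite -id_; congr (_ - _ * _); apply: eq_Rintegral => s.
  by rewrite inE/= in_itv/= => /andP[sa _]; rewrite ger0_norm// subr_ge0.
have right_half : (b - x) `^ alpha * f b - alpha *
    \int[@lebesgue_measure R]_(t in `[x, b]) ((b - t) `^ (alpha - 1) * f t) =
    (b - x) `^ (alpha + 1) * \int[@lebesgue_measure R]_(t in `[0, 1])
          ((1 - t `^ alpha) * derive1 f (t * x + (1 - t) * b)).
  move: xab; rewrite in_itv/= => /andP[ax]; rewrite le_eqVlt => /predU1P[->|xb].
    rewrite (p0 _ _ a0) (p0 _ _ a10) 2!mul0r.
    by rewrite set_itv1 Rintegral_set1 mulr0 subr0.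
  (* here v = x - b is negative: |v|^alpha * v = - (b - x)^(alpha + 1), and the
     sign turns t^alpha - 1 into 1 - t^alpha *)
  have v0 : x - b < 0 by rewrite subr_lt0.
  have w0 : 0 < b - x by rewrite subr_gt0.
  have sub : `[x, b] `<=` `[a, b] by apply: subset_itvr; rewrite bnd_simp.
  have DE : `[x, b]%classic =
      (fun s : R => - b / (x - b) + s * (x - b)^-1) @^-1` `[0, 1].
    apply/seteqP; split => s /=; rewrite -mulrDl addrC !in_itv/= ler_ndivrMr//
      ler_ndivlMr// mul0r mul1r subr_le0 lerD2r andbC//.
  have dfx (t : R) : t \in `]0, 1[ ->
      is_derive (b + t * (x - b)) 1 f (derive1 f (b + t * (x - b))).
    rewrite in_itv/= => /andP[t0 t1]; apply: df; rewrite in_itv/=.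
    by apply/andP; split; nra.
  have intdf : (@lebesgue_measure R).-integrable `[x, b] (EFin \o derive1 f).
    by apply: integrableS hint.
  have [intK id_] := endpoint_identity (ltr0_neq0 v0) a0 DE
    (continuous_subspaceW sub hcont) dfx intdf.
  have vE : (b - x) `^ (alpha + 1) = (b - x) `^ alpha * (b - x).
    by rewrite powRD ?powRr1 ?(ltW w0)// (gt_eqF w0) implybT.
  rewrite (ltr0_norm v0) opprB in id_.
  have -> : \int[@lebesgue_measure R]_(t in `[0, 1])
      ((1 - t `^ alpha) * derive1 f (t * x + (1 - t) * b)) =
    -1 * \int[@lebesgue_measure R]_(t in `[0, 1])
      ((t `^ alpha - 1) * derive1 f (b + t * (x - b))).
    rewrite -RintegralZl//; apply: eq_Rintegral => t _.
    rewrite (_ : t * x + (1 - t) * b = b + t * (x - b)); ring.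
  have opp_l (u w z : R) : u * w * (-1 * z) = u * (- w) * z by ring.
  rewrite vE opp_l opprB -id_.
  congr (_ - _ * _); apply: eq_Rintegral => s.
  rewrite inE/= in_itv/= => /andP[_ sb].
  by rewrite distrC ger0_norm// subr_ge0.
have rhsE (p q r s w : R) : p / w * q + r / w * s = (p * q + r * s) / w.
  by ring.
rewrite rhsE -left_half -right_half GammaS// /RLminus /RLplus; field.
by rewrite ba0 gt_eqF.
Qed.
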